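(* Let $\Sigma$ be a simplicial complex whose vertex set is endowed with a total order, and for each $k \geq 0$ let $\Sigma_{k+1}$ denote the set of $(k+1)$-simplices of $\Sigma$. Order the $k$-simplices of $\Sigma$ lexicographically by their increasingly ordered vertex lists, and order pairs $(\sigma_0 < \sigma_1)$ of distinct $k$-simplices (written with the smaller first) lexicographically: $(\sigma_0<\sigma_1) < (\tau_0<\tau_1)$ iff $\sigma_0<\tau_0$, or $\sigma_0=\tau_0$ and $\sigma_1<\tau_1$. Let $P_k$ be the set of pairs $(\sigma_0 < \sigma_1)$ of distinct $k$-simplices of $\Sigma$ such that (a) $\tau := \sigma_0 \cup \sigma_1 \in \Sigma_{k+1}$, and (b) $(\sigma_0 < \sigma_1)$ is minimal among all pairs of $k$-faces of the common $(k+1)$-dimensional coface $\tau$; equivalently, $\sigma_0$ and $\sigma_1$ are the smallest and second-smallest $k$-faces of $\tau$ in the lexicographic order. Then: (1) For every $k > 1$, there is a bijection between $P_k$ and $\Sigma_{k+1}$. (2) If $k > 1$, then for every pair $(\sigma_0 < \sigma_1) \in P_k$, the simplices $\sigma_0$ and $\sigma_1$ have a common $(k-1)$-face $\rho \in \Sigma$, and $\rho$ is the minimal (in the lexicographic order) $(k-1)$-face of $\tau = \sigma_0\cup\sigma_1$, and also the minimal $(k-1)$-face of both $\sigma_0$ and $\sigma_1$.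
   Context: A $j$-simplex is a simplex with $j+1$ vertices; a $j$-face of a simplex is a subset with $j+1$ vertices. *)

(* Defs.v *)
From mathcomp Require Import all_boot all_order finmap classical_sets functions.
Set Implicit Arguments.
Unset Strict Implicit.
Unset Printing Implicit Defensive.
Import Order.TTheory.

Local Open Scope fset_scope.

(* [V] is the whole vertex set; simplices are nonempty finite sets of vertices.
   The complex itself may be infinite. *)
Record simplicial_complex (V : choiceType) := SimplicialComplex {
  simplex :> {fset V} -> Prop;
  simplex_vertex : forall v : V, simplex [fset v];
  simplex_neq0 : forall s, simplex s -> s != fset0;
  simplex_face : forall s t, simplex s -> t `<=` s -> t != fset0 -> simplex t
}.

Section Faces.
Variable V : choiceType.

Definition ksimplices (X : simplicial_complex V) (k : nat) : set {fset V} :=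
  [set s | X s /\ #|` s| = k.+1]%classic.

Definition kfaces (k : nat) (s : {fset V}) : set {fset V} :=
  [set t | (t `<=` s)%fset /\ #|` t| = k.+1]%classic.

End Faces.

Section LexOrder.
Variables (d : Order.disp_t) (V : orderType d).

Definition vertex_list (s : {fset V}) : seqlexi V := sort <=%O (enum_fset s).

Definition lex_le (s t : {fset V}) : Prop :=
  (vertex_list s <= vertex_list t)%O.

Definition lex_lt (s t : {fset V}) : Prop :=
  (vertex_list s < vertex_list t)%O.

Definition pair_lt (p q : {fset V} * {fset V}) : Prop :=
  lex_lt p.1 q.1 \/ p.1 = q.1 /\ lex_lt p.2 q.2.

Definition lex_pairs (A : set {fset V}) : set ({fset V} * {fset V}) :=
  [set p | [/\ A p.1, A p.2 & lex_lt p.1 p.2]]%classic.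

Definition minimal_pair (A : set {fset V}) (p : {fset V} * {fset V}) : Prop :=
  lex_pairs A p /\ forall q, lex_pairs A q -> ~ pair_lt q p.

Definition lex_smallest (A : set {fset V}) (s : {fset V}) : Prop :=
  A s /\ forall t, A t -> lex_le s t.

Definition lex_two_smallest (A : set {fset V}) (s0 s1 : {fset V}) : Prop :=
  lex_smallest A s0 /\ lex_smallest [set t | A t /\ t <> s0]%classic s1.

Definition minimal_pairs (X : simplicial_complex V) (k : nat) :
    set ({fset V} * {fset V}) :=
  [set p | [/\ lex_pairs (ksimplices X k) p,
               ksimplices X k.+1 (p.1 `|` p.2)%fset &
               minimal_pair (kfaces k (p.1 `|` p.2)%fset) p]]%classic.

End LexOrder.

(* Main.v *)
(* If tau has increasing vertex list l, a, v, then its lexicographically smallest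
   and second smallest k-faces are l, a and l, v (a face other than l, a that
   agrees with l can only end in v).  Their union is tau and their intersection is
   l.  As l is an initial segment of the lists of tau, of l, a and of l, v alike,
   it is the smallest (k-1)-face of all three. *)
Require Import Defs.
From mathcomp Require Import all_boot all_order finmap classical_sets functions.
Set Implicit Arguments.
Unset Strict Implicit.
Unset Printing Implicit Defensive.
Import Order.TTheory.

Section LexSubseq.
Variables (d : Order.disp_t) (V : orderType d).
Implicit Types (l u : seqlexi V) (a v : V).

(** Induction on [l]: if [u] has the same head, the tails decide; otherwise the head of [u] occurs
    later in a strictly increasing list, so it is larger and settles the comparison. *)
Lemma subseq_lexi_prefix l l' u :
  sorted <%O (l ++ l') -> subseq u (l ++ l') -> size u = size l ->
  (l <= u)%O.
Proof.
elim: l u => [|y l IHl] [|x u] //= ltl sub_u [sz_u].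
have ltl' := path_sorted ltl.
case: (eqVneq x y) sub_u => [->|_] sub_u.
  by rewrite eqhead_lexiE IHl.
have x_in: x \in l ++ l' by rewrite (mem_subseq sub_u) ?mem_head.
have lt_yx: (y < x)%O by move/allP: (order_path_min lt_trans ltl); apply.
by rewrite neqhead_lexiE // (lt_eqF lt_yx).
Qed.

(** Same induction; once [l] is exhausted, [u] is a single letter among [a] and [v], and [a] is
    excluded. *)
Lemma subseq_lexi_second l a v u :
  sorted <%O (l ++ [:: a; v]) -> subseq u (l ++ [:: a; v]) ->
  size u = (size l).+1 -> u <> l ++ [:: a] -> (l ++ [:: v] <= u :> seqlexi V)%O.
Proof.
elim: l u => [|y l IHl] [|x u] // ltl sub_u [sz_u] neq_u.
  have u0 := size0nil sz_u; rewrite u0 in sub_u neq_u *.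
  have: x \in [:: a; v] by rewrite (mem_subseq sub_u) ?mem_head.
  by rewrite !inE => /orP[]/eqP x_eq; rewrite x_eq // in neq_u *.
have ltl' := path_sorted ltl; rewrite /= in sub_u.
case: (eqVneq x y) neq_u sub_u => [->|_] neq_u sub_u.
  by rewrite eqhead_lexiE IHl // => u_eq; rewrite u_eq in neq_u.
have x_in: x \in l ++ [:: a; v] by rewrite (mem_subseq sub_u) ?mem_head.
have lt_yx: (y < x)%O by move/allP: (order_path_min lt_trans ltl); apply.
by rewrite neqhead_lexiE // (lt_eqF lt_yx).
Qed.

End LexSubseq.

Section VertexList.
Variables (d : Order.disp_t) (V : orderType d).
Implicit Types (s t : {fset V}) (l : seq V).

Lemma mem_vertex_list s : vertex_list s =i s.
Proof. by move=> x; rewrite mem_sort. Qed.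

Lemma size_vertex_list s : size (vertex_list s) = #|` s|.
Proof. exact: size_sort. Qed.

Lemma vertex_list_sorted s : sorted <%O (vertex_list s : seq V).
Proof. by rewrite sort_lt_sorted fset_uniq. Qed.

Lemma vertex_list_inj : injective (@vertex_list d V).
Proof.
by move=> s t eq_st; apply/fsetP => x; rewrite -!mem_vertex_list eq_st.
Qed.

Lemma vertex_list_seq_fset l :
  sorted <%O l -> vertex_list [fset x in l]%fset = l.
Proof.
move=> ltl; apply: lt_sorted_eq => //; first exact: vertex_list_sorted.
by move=> x; rewrite mem_vertex_list !inE.
Qed.

Lemma card_seq_fset l : sorted <%O l -> #|` [fset x in l]%fset| = size l.
Proof. by move=> ltl; rewrite -size_vertex_list vertex_list_seq_fset. Qed.

(** Filtering the list of [t] by membership in [s] leaves a strictly increasing list with the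
    elements of [s], and only one such list exists. This carries questions about faces over to
    subsequences. *)
Lemma subseq_vertex_list s t :
  (s `<=` t)%fset -> subseq (vertex_list s) (vertex_list t).
Proof.
move=> /fsubsetP sub_st.
have -> : (vertex_list s : seq V) = [seq x <- vertex_list t | x \in s].
  apply: lt_sorted_eq; first exact: vertex_list_sorted.
    exact: subseq_lt_sorted (filter_subseq _ _) (vertex_list_sorted t).
  move=> x; rewrite mem_filter !mem_vertex_list.
  by case: (boolP (x \in s)) => // /sub_st ->.
exact: filter_subseq.
Qed.

End VertexList.

Section LexMinimal.
Variables (d : Order.disp_t) (V : orderType d).
Implicit Types (A : set {fset V}) (s t : {fset V}).

Lemma lex_lt_neqAle s t : lex_lt s t <-> s <> t /\ lex_le s t.
Proof.
rewrite /lex_lt /lex_le lt_neqAle (inj_eq (@vertex_list_inj _ V)).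
by split=> [/andP[/eqP]|[/eqP-> ->]].
Qed.

Lemma lex_leNgt s t : lex_le s t <-> ~ lex_lt t s.
Proof. by rewrite /lex_lt /lex_le leNgt; split=> [/negP|/negP]. Qed.

Lemma lex_smallest_uniq A s t : lex_smallest A s -> lex_smallest A t -> s = t.
Proof.
move=> [As le_s] [At le_t]; apply: vertex_list_inj.
by apply/eqP; rewrite eq_le (le_s _ At : is_true _) (le_t _ As : is_true _).
Qed.

Lemma lex_two_smallest_uniq A s0 s1 t0 t1 :
  lex_two_smallest A s0 s1 -> lex_two_smallest A t0 t1 ->
  (s0, s1) = (t0, t1).
Proof.
move=> [min_s0 min_s1] [min_t0 min_t1].
have eq0 := lex_smallest_uniq min_s0 min_t0; rewrite -eq0 in min_t1 *.
by rewrite (lex_smallest_uniq min_s1 min_t1).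
Qed.

(** A member [t] below [s0] would give the smaller pair [(t, s0)], and one other than [s0] below
    [s1] the smaller pair [(s0, t)]. Conversely, a smaller pair would improve on [s0] or, with first
    entry [s0], on [s1]. *)
Lemma minimal_pairP A s0 s1 :
  minimal_pair A (s0, s1) <-> lex_two_smallest A s0 s1.
Proof.
split=> [[[/= As0 As1 lt01] min_s]|[[As0 min_s0] [[As1 neq10] min_s1]]].
  have le_s0 t : A t -> lex_le s0 t.
    move=> At; apply/lex_leNgt => lt_t0.
    by apply: (min_s (t, s0)); [split | left].
  split; split=> //.
    split=> // eq10; rewrite eq10 in lt01; by case/lex_lt_neqAle: lt01.
  move=> t [At neq_t0]; apply/lex_leNgt => lt_t1.
  apply: (min_s (s0, t)); last by right.
  by split=> //=; apply/lex_lt_neqAle; split; [exact: nesym | exact: le_s0].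
split.
  by split=> //=; apply/lex_lt_neqAle; split; [exact: nesym | exact: min_s0].
move=> [t0 t1] [/= At0 At1 lt_t] [/= lt0|/= [eq0 lt1]].
  by move/lex_leNgt: (min_s0 _ At0).
rewrite eq0 in lt_t; case/lex_lt_neqAle: lt_t => neq_t _.
by move/lex_leNgt: (min_s1 t1 (conj At1 (nesym neq_t))).
Qed.

End LexMinimal.

Section SmallestFaces.
Variables (d : Order.disp_t) (V : orderType d).
Implicit Types (X : simplicial_complex V) (s t : {fset V}) (l : seq V).

Lemma lex_smallest_prefix k s l l' :
  vertex_list s = l ++ l' -> size l = k.+1 ->
  lex_smallest (kfaces k s) [fset x in l]%fset.
Proof.
move=> def_s sz_l; have lt_s := vertex_list_sorted s; rewrite def_s in lt_s.
have lt_l := subseq_lt_sorted (prefix_subseq l l') lt_s.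
split; first split.
- by apply/fsubsetP => x; rewrite inE -mem_vertex_list def_s mem_cat => ->.
- by rewrite card_seq_fset.
move=> t [/subseq_vertex_list sub_ts sz_t].
rewrite /lex_le vertex_list_seq_fset //.
rewrite def_s in sub_ts; apply: subseq_lexi_prefix lt_s sub_ts _.
by rewrite size_vertex_list sz_t sz_l.
Qed.

Lemma lex_two_smallest_prefix s l a v :
  vertex_list s = l ++ [:: a; v] ->
  lex_two_smallest (kfaces (size l) s)
    [fset x in l ++ [:: a]]%fset [fset x in l ++ [:: v]]%fset.
Proof.
move=> def_s; have lt_s := vertex_list_sorted s; rewrite def_s in lt_s.
have sub_lv: subseq (l ++ [:: v]) (l ++ [:: a; v]).
  by apply: cat_subseq => //; exact: subseq_cons.
have sub_la: subseq (l ++ [:: a]) (l ++ [:: a; v]).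
  by apply: cat_subseq => //; exact: (prefix_subseq [:: a]).
have lt_lv := subseq_lt_sorted sub_lv lt_s.
have lt_la := subseq_lt_sorted sub_la lt_s.
split.
  by apply: (@lex_smallest_prefix _ _ _ [:: v]); rewrite -?catA ?size_cat ?addn1.
split; first split; first split.
- apply/fsubsetP => x; rewrite -(mem_vertex_list s) def_s mem_cat !inE.
  by case: (x \in l) => //=; rewrite orbF => ->; rewrite orbT.
- by rewrite card_seq_fset // size_cat addn1.
(* Were the two faces equal, their lists would give [v = a], but the list of [s] increases strictly
   from [a] to [v]. *)
- move/(congr1 (@vertex_list _ V)); rewrite !vertex_list_seq_fset //.
  move/eqP; rewrite eqseq_cat // eqxx => /eqP [eq_va].
  move: lt_s; rewrite eq_va => /(subseq_lt_sorted (suffix_subseq _ _)) /=.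
  by rewrite ltxx.
move=> t [[/subseq_vertex_list sub_ts sz_t] neq_t].
rewrite /lex_le vertex_list_seq_fset //.
rewrite def_s in sub_ts; apply: subseq_lexi_second lt_s sub_ts _ _.
  by rewrite size_vertex_list.
move=> eq_t; apply: neq_t; apply: vertex_list_inj.
by rewrite vertex_list_seq_fset.
Qed.

Lemma vertex_list_split2 s k :
  #|` s| = k.+2 ->
  exists l a v, vertex_list s = l ++ [:: a; v] /\ size l = k.
Proof.
rewrite -size_vertex_list; case/lastP: (vertex_list s) => // u v.
rewrite size_rcons => -[]; case/lastP: u => // l a.
by rewrite size_rcons => -[sz_l]; exists l, a, v; rewrite -!cats1 -catA.
Qed.

Lemma simplex_kface X k s t :
  simplex X s -> kfaces k s t -> ksimplices X k t.
Proof.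
move=> Xs [sub_ts sz_t]; split=> //; apply: simplex_face Xs sub_ts _.
by rewrite -cardfs_eq0 sz_t.
Qed.

End SmallestFaces.

Theorem theorem2p5 (d : Order.disp_t) (V : orderType d)
    (X : simplicial_complex V) :
  [/\ forall (k : nat) (s0 s1 : {fset V}),
        lex_pairs (ksimplices X k) (s0, s1) ->
        ksimplices X k.+1 (s0 `|` s1)%fset ->
        minimal_pair (kfaces k (s0 `|` s1)%fset) (s0, s1) <->
        lex_two_smallest (kfaces k (s0 `|` s1)%fset) s0 s1,
      forall k : nat, (1 < k)%N ->
        exists f : {fset V} * {fset V} -> {fset V},
          set_bij (minimal_pairs X k) (ksimplices X k.+1) f
    & forall k : nat, (1 < k)%N ->
        forall s0 s1 : {fset V}, minimal_pairs X k (s0, s1) ->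
        exists r : {fset V},
          [/\ X r,
              kfaces k.-1 s0 r /\ kfaces k.-1 s1 r,
              lex_smallest (kfaces k.-1 (s0 `|` s1)%fset) r,
              lex_smallest (kfaces k.-1 s0) r
            & lex_smallest (kfaces k.-1 s1) r]].
Proof.
split=> [k s0 s1 _ _|k _|[|k] // _ s0 s1 [_ [Xt sz_t]]].
- exact: minimal_pairP.
(* The bijection is the union. It is injective because the union determines its two smallest
   [k]-faces. *)
- exists (fun p => p.1 `|` p.2)%fset; split.
  + by move=> p [].
  + move=> [s0 s1] [t0 t1] /set_mem[_ _ /= min_s] /set_mem[_ _ /= min_t] eq_st.
    rewrite -eq_st in min_t.
    by apply: lex_two_smallest_uniq; apply/minimal_pairP; eassumption.
  (* Surjectivity: the preimage of [t] omits its last vertex [v] in one face and its next-to-last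
     vertex [a] in the other. *)
  + move=> t [Xt sz_t]; have [l [a [v [def_t sz_l]]]] := vertex_list_split2 sz_t.
    have := lex_two_smallest_prefix def_t; rewrite sz_l => /minimal_pairP min_t.
    set s0 := [fset x in l ++ [:: a]]%fset in min_t.
    set s1 := [fset x in l ++ [:: v]]%fset in min_t.
    have def_U: (s0 `|` s1)%fset = t.
      apply/fsetP => x; rewrite !inE -mem_vertex_list def_t !mem_cat !inE.
      by case: (x \in l); case: (x == a); case: (x == v).
    exists (s0, s1) => //; split=> /=; rewrite ?def_U //.
    case: min_t => -[/= face0 face1 lt01] _.
    by split=> //=; apply: simplex_kface; eassumption.
(* The dimension is now written [k.+1], so [l] has [k.+1] vertices and spans a [k]-face, the common
   face sought. *)
have [l [a [v [def_t sz_l]]]] := vertex_list_split2 sz_t.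
move=> /= /minimal_pairP min_s; have := lex_two_smallest_prefix def_t.
(* Uniqueness of the two smallest faces forces [s0] and [s1] to be spanned by [l, a] and [l, v]. *)
rewrite sz_l => /(lex_two_smallest_uniq min_s) [def0 def1].
have lt_t := vertex_list_sorted (s0 `|` s1)%fset; rewrite def_t in lt_t.
have min_t := lex_smallest_prefix def_t sz_l.
(* As a subsequence of the list of the union, [l ++ [:: a]] is strictly increasing, hence it is the
   vertex list of [s0] and [l] is a prefix of it; likewise for [s1] with [v]. *)
have min0: lex_smallest (kfaces k s0) [fset x in l]%fset.
  apply: (@lex_smallest_prefix _ _ _ _ _ [:: a]) => //.
  rewrite def0 vertex_list_seq_fset //; apply: subseq_lt_sorted lt_t.
  by apply: cat_subseq => //; exact: (prefix_subseq [:: a]).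
have min1: lex_smallest (kfaces k s1) [fset x in l]%fset.
  apply: (@lex_smallest_prefix _ _ _ _ _ [:: v]) => //.
  rewrite def1 vertex_list_seq_fset //; apply: subseq_lt_sorted lt_t.
  by apply: cat_subseq => //; exact: subseq_cons.
exists [fset x in l]%fset; split=> //.
- by case: (simplex_kface Xt min_t.1).
- by split; [exact: min0.1 | exact: min1.1].
Qed.
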